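(* Let $X\in(0,\infty]$, $\sigma>0$, $N\in\mathbb{N}$ with $N\ge 1$, and let $Q\in C([0,X))$ be non-negative with $Q(0)=0$ and such that $L_0:=\lim_{r\downarrow 0}Q(r)/r^2$ exists in $[0,\infty)$. Consider the three radial problems $$\mathrm{(R)}\quad \phi'(r)=-r\,\phi(r)^2-\frac{N}{r}\phi(r)+\frac{Q(r)}{\sigma^4 r},\quad r\in(0,X),\qquad \phi(0)=0,$$ $$\mathrm{(S)}\quad u''(r)+\frac{N-1}{r}u'(r)-\frac{Q(r)}{\sigma^4}u(r)=0,\quad r\in(0,X),\qquad u(0)=1,\ u'(0)=0,$$ $$\mathrm{(H)}\quad z''(r)+\frac{N-1}{r}z'(r)-\frac{1}{2\sigma^2}(z'(r))^2+\frac{2Q(r)}{\sigma^2}=0,\quad r\in(0,X),\qquad z(0)=0,\ z'(0)=0,$$ and assume that one of the three problems admits a regular classical solution. Then all three admit unique regular classical solutions $\phi\in C^1([0,X))$, $u\in C^2([0,X))$ with $u\ge 1$, and $z\in C^2([0,X))$, related by the bijective maps $$\phi(r)=\frac1r\frac{u'(r)}{u(r)},\qquad z(r)=-2\sigma^2\ln u(r),\qquad u(r)=\exp\!\bigl(-z(r)/(2\sigma^2)\bigr).$$ Moreover: (i) $\phi(r)>0$ for $r\in(0,X)$ if and only if $u'(r)>0$ for $r\in(0,X)$, if and only if $z'(r)<0$ for $r\in(0,X)$; (ii) under the additional hypothesis that $Q$ is monotone non-decreasing on $(0,X)$, $u$ is strictly convex on $[0,X)$ and $z$ is strictly concave on $[0,X)$;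 (iii) if $X=\infty$ and $L:=\lim_{r\to\infty}Q(r)/r^2$ exists with $L\in(0,\infty)$, then $\phi$ extends to $[0,\infty)$ with $\lim_{r\to\infty}\phi(r)=\sqrt{L}/\sigma^2$.
   Context: A regular classical solution of (R), (S), (H) means, respectively, a function in $C^1([0,X))$, $C^2([0,X))$, $C^2([0,X))$ that satisfies the equation on $(0,X)$ and the stated initial conditions at $r=0$.
   Formalization: Part (ii) is proved under the extra hypothesis that φ>0 on (0,X): without it Q≡0 gives u≡1, z≡0, which are not strictly convex/concave; the hypothesis is necessary, since strict convexity of u with u'(0)=0 forces u'>0. *)

(* Defs.v *)
From Stdlib Require Export Reals.
From Coquelicot Require Export Coquelicot.
Open Scope R_scope.

(* The intervals [0,X) and (0,X), for X a finite real or +oo. *)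
Definition Ico (X : Rbar) (r : R) : Prop := 0 <= r /\ Rbar_lt r X.
Definition Ioo (X : Rbar) (r : R) : Prop := 0 < r /\ Rbar_lt r X.

(* Functions on [0,X) are represented by total functions R -> R of which only
   the values on [0,X) matter; equality of such functions is [eq_on]. *)
Definition eq_on (D : R -> Prop) (f g : R -> R) : Prop :=
  forall r, D r -> f r = g r.

Definition continuous_on (D : R -> Prop) (f : R -> R) : Prop :=
  forall r, D r -> continue_in f D r.

(* Derivative relative to the set D: on [0,X) it is the usual derivative at
   interior points and the right derivative at 0. *)
Definition deriv_on (D : R -> Prop) (f f1 : R -> R) : Prop :=
  forall r, D r -> D_in f f1 D r.

Definition C1_on (D : R -> Prop) (f f1 : R -> R) : Prop :=
  deriv_on D f f1 /\ continuous_on D f1.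

Definition C2_on (D : R -> Prop) (f f1 f2 : R -> R) : Prop :=
  deriv_on D f f1 /\ deriv_on D f1 f2 /\ continuous_on D f2.

Definition regular_sol_R (X : Rbar) (sigma : R) (N : nat) (Q phi : R -> R) : Prop :=
  exists phi1 : R -> R,
    C1_on (Ico X) phi phi1 /\
    (forall r, Ioo X r ->
       phi1 r = - r * phi r ^ 2 - INR N / r * phi r + Q r / (sigma ^ 4 * r)) /\
    phi 0 = 0.

Definition regular_sol_S (X : Rbar) (sigma : R) (N : nat) (Q u : R -> R) : Prop :=
  exists u1 u2 : R -> R,
    C2_on (Ico X) u u1 u2 /\
    (forall r, Ioo X r ->
       u2 r + (INR N - 1) / r * u1 r - Q r / sigma ^ 4 * u r = 0) /\
    u 0 = 1 /\ u1 0 = 0.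

Definition regular_sol_H (X : Rbar) (sigma : R) (N : nat) (Q z : R -> R) : Prop :=
  exists z1 z2 : R -> R,
    C2_on (Ico X) z z1 z2 /\
    (forall r, Ioo X r ->
       z2 r + (INR N - 1) / r * z1 r - 1 / (2 * sigma ^ 2) * z1 r ^ 2
         + 2 * Q r / sigma ^ 2 = 0) /\
    z 0 = 0 /\ z1 0 = 0.

Definition exists_unique_on (D : R -> Prop) (P : (R -> R) -> Prop) : Prop :=
  exists f, P f /\ forall g, P g -> eq_on D g f.

(* The relation G is the graph of a bijection from A onto B, functions being
   identified when they agree on D. *)
Definition bijective_graph (D : R -> Prop) (A B : (R -> R) -> Prop)
    (G : (R -> R) -> (R -> R) -> Prop) : Prop :=
  (forall f, A f -> exists_unique_on D (fun g => B g /\ G f g)) /\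
  (forall g, B g -> exists_unique_on D (fun f => A f /\ G f g)).

(* The quotient defining phi only makes sense for r > 0; the value phi(0) = 0
   is fixed by the initial condition. *)
Definition graph_S_R (X : Rbar) (u phi : R -> R) : Prop :=
  exists u1, deriv_on (Ico X) u u1 /\
    forall r, Ioo X r -> phi r = 1 / r * (u1 r / u r).

Definition graph_S_H (X : Rbar) (sigma : R) (u z : R -> R) : Prop :=
  forall r, Ico X r -> z r = - 2 * sigma ^ 2 * ln (u r).

Definition graph_H_S (X : Rbar) (sigma : R) (z u : R -> R) : Prop :=
  forall r, Ico X r -> u r = exp (- z r / (2 * sigma ^ 2)).

Definition nondecreasing_on (D : R -> Prop) (f : R -> R) : Prop :=
  forall r s, D r -> D s -> r <= s -> f r <= f s.

Definition strictly_convex_on (D : R -> Prop) (f : R -> R) : Prop :=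
  forall x y t, D x -> D y -> x <> y -> 0 < t < 1 ->
    f (t * x + (1 - t) * y) < t * f x + (1 - t) * f y.

Definition strictly_concave_on (D : R -> Prop) (f : R -> R) : Prop :=
  forall x y t, D x -> D y -> x <> y -> 0 < t < 1 ->
    t * f x + (1 - t) * f y < f (t * x + (1 - t) * y).

(* Main.v *)
From Stdlib Require Import Ranalysis5 Lra Lia.
Require Import Defs.

(** The substitutions [u' = r phi u] and [u = exp (- z / (2 sigma ^ 2))] turn the
    Riccati problem (R) and the problem (H) into the linear problem (S), which
    reads [u'' + (n / r) u' = W u] with [n = N - 1] and [W = Q / sigma ^ 4 >= 0].
    Everything is therefore proved for (S) and carried back.

    Multiplied by [r ^ n] the linear equation takes divergence form
    ([is_derive_flux]). The energy [r ^ n u u'] is nondecreasing, so [u ^ 2] is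
    nondecreasing and [u >= 1] ([radial_ge_1]); hence logarithms and quotients
    by [u] make sense. The weighted Wronskian of two solutions vanishes, so (S)
    has at most one solution ([radial_unique]), and uniqueness for (R) and (H)
    follows because each of their solutions produces one of (S).

    Regularity is delicate only at [r = 0] and only from (S) to (R). There the
    quadratic decay of [Q] gives [u' = O(r ^ 3)] ([radial_deriv_small]), so
    [phi = O(r ^ 2)] and [phi'] has limit [0] ([radial_sol_R]). By the mean value
    theorem one-sided derivatives at [0] need not be computed: it is enough that
    the interior derivative extends continuously ([deriv_on_of_interior]).

    Convexity of [u] and concavity of [z] both reduce to the strict monotonicity
    of [u' / u = r phi], since [u' = (r phi) u] and
    [z' = - 2 sigma ^ 2 (r phi)]. If its derivative failed to be positive at
    some point, the value there would be a constant supersolution to the left of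
    that point, which is incompatible with the value [0] at the origin
    ([radial_log_deriv_incr]).

    At infinity (R) reads [phi' = r (q - phi ^ 2) - (N / r) phi] with
    [q -> L / sigma ^ 4]; the levels slightly above and below the square root of
    that limit are barriers, and [phi] is trapped between them
    ([riccati_limit]). *)

(** * Calculus on the half-open interval *)

Lemma Ioo_Ico (X : Rbar) (r : R) : Ioo X r -> Ico X r.
Proof. unfold Ioo, Ico; intuition lra. Qed.

Lemma Ico_le (X : Rbar) (r s : R) : Ico X s -> 0 <= r <= s -> Ico X r.
Proof.
  intros [Hs HX] Hr; split; [lra |].
  apply (Rbar_le_lt_trans r s X); [simpl; lra | exact HX].
Qed.

Lemma Ioo_le (X : Rbar) (r s : R) : Ico X s -> 0 < r <= s -> Ioo X r.
Proof. intros Hs Hr; split; [lra |]. apply (Ico_le X r s); [exact Hs | lra]. Qed.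

Lemma Ico_0 (X : Rbar) : Rbar_lt 0 X -> Ico X 0.
Proof. intros HX; split; [lra | exact HX]. Qed.

Lemma Ico_cases (X : Rbar) (r : R) : Ico X r -> r = 0 \/ Ioo X r.
Proof.
  intros [Hr HX]; destruct (Req_dec r 0); [left; assumption |].
  right; split; [lra | exact HX].
Qed.

Lemma locally_Ioo (X : Rbar) (r : R) : Ioo X r -> locally r (Ioo X).
Proof.
  intros [Hr HX]; apply (filter_and (F := locally r)).
  - apply (open_gt 0); exact Hr.
  - apply (open_Rbar_lt X); exact HX.
Qed.

Lemma continue_in_eps (f : R -> R) (D : R -> Prop) (x : R) :
  continue_in f D x <->
  forall eps, 0 < eps -> exists del, 0 < del /\
    forall y, D y -> Rabs (y - x) < del -> Rabs (f y - f x) < eps.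
Proof.
  split; intros H eps He; destruct (H eps He) as (del & Hd & Hy);
    exists del; split; try exact Hd.
  - intros y Dy Hyx. destruct (Req_dec x y) as [<- | Hne].
    + replace (f x - f x) with 0 by ring. rewrite Rabs_R0; exact He.
    + apply (Hy y). split; [split; assumption | exact Hyx].
  - intros y [[Dy _] Hyx]. apply (Hy y Dy Hyx).
Qed.

Lemma continue_in_subset (f : R -> R) (D E : R -> Prop) (x : R) :
  (forall y, D y -> E y) -> continue_in f E x -> continue_in f D x.
Proof.
  rewrite !continue_in_eps. intros HDE H eps He.
  destruct (H eps He) as (del & Hd & Hy). exists del; split; [exact Hd |].
  intros y Dy; apply Hy; auto.
Qed.

Lemma continuous_continue_in (f : R -> R) (D : R -> Prop) (x : R) :
  continuous f x -> continue_in f D x.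
Proof.
  intros H; apply continue_in_eps; intros eps He.
  destruct (proj1 (filterlim_locally f (f x)) H (mkposreal eps He)) as [del Hd].
  exists del; split; [apply cond_pos |]. intros y _ Hy. exact (Hd y Hy).
Qed.

Lemma continuous_interior (X : Rbar) (f : R -> R) (r : R) :
  continuous_on (Ioo X) f -> Ioo X r -> continuous f r.
Proof.
  intros Hf Hr. apply filterlim_locally. intros eps.
  destruct (proj1 (continue_in_eps f (Ioo X) r) (Hf r Hr) eps (cond_pos eps))
    as (del & Hd & Hy).
  generalize (filter_and (F := locally r) _ _ (locally_Ioo X r Hr)
                (locally_ball r (mkposreal del Hd))).
  apply filter_imp. intros y [Dy Hyr]. exact (Hy y Dy Hyr).
Qed.

(** Extending by the value at [0] makes a one-sidedly continuous function
    continuous at [0], so that theorems on compact intervals apply up to [0]. *)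
Lemma continuous_clamp (X : Rbar) (f : R -> R) (r : R) :
  Rbar_lt 0 X -> continuous_on (Ico X) f -> Rbar_lt r X ->
  continuous (fun s => f (Rmax 0 s)) r.
Proof.
  intros HX Hf Hr. apply filterlim_locally. intros eps.
  assert (Hm : forall s : R, Rbar_lt s X -> Ico X (Rmax 0 s)).
  { intros s Hs. split; [apply Rmax_l |].
    unfold Rmax; destruct (Rle_dec 0 s); assumption. }
  destruct (proj1 (continue_in_eps f (Ico X) _) (Hf _ (Hm r Hr)) eps
              (cond_pos eps)) as (del & Hd & Hy).
  generalize (filter_and (F := locally r) _ _ (open_Rbar_lt X r Hr)
                (locally_ball r (mkposreal del Hd))).
  apply filter_imp. intros s [Ds Hsr]. apply (Hy (Rmax 0 s) (Hm s Ds)).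
  apply Rle_lt_trans with (2 := Hsr).
  unfold Rmax, abs, minus, plus, opp; simpl.
  destruct (Rle_dec 0 s), (Rle_dec 0 r); unfold Rabs;
    repeat destruct (Rcase_abs _); lra.
Qed.

Lemma continuity_pt_clamp (X : Rbar) (f : R -> R) (b c : R) :
  Rbar_lt 0 X -> continuous_on (Ico X) f -> Ico X b -> c <= b ->
  continuity_pt (fun s => f (Rmax 0 s)) c.
Proof.
  intros HX Hf [_ Hb] Hc. apply continuity_pt_filterlim.
  apply (continuous_clamp X f c HX Hf).
  apply (Rbar_le_lt_trans c b X); [exact Hc | exact Hb].
Qed.

Lemma MVT_Ico (X : Rbar) (f f1 : R -> R) (a b : R) :
  Rbar_lt 0 X -> continuous_on (Ico X) f ->
  (forall r, Ioo X r -> is_derive f r (f1 r)) ->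
  0 <= a < b -> Ico X b ->
  exists c, a < c < b /\ f b - f a = f1 c * (b - a).
Proof.
  intros HX Hc Hd Hab Hb.
  set (g := fun s => f (Rmax 0 s)).
  assert (Hg : forall c, a < c < b -> derivable_pt_lim g c (f1 c)).
  { intros c Hcab. apply is_derive_Reals.
    apply (is_derive_ext_loc f); [| apply Hd; apply (Ioo_le X c b Hb); lra].
    generalize (open_gt 0 c ltac:(lra)). apply filter_imp.
    intros s Hs. unfold g. now rewrite Rmax_right by lra. }
  (* Only interior derivatives are available at [a = 0], hence Cauchy's form
     of the theorem, which asks for no derivative at the end points. *)
  destruct (MVT g id a b
    (fun c P => exist _ (f1 c) (Hg c P))
    (fun c _ => derivable_pt_id c)) as (c & P & Hmvt).
  - lra.
  - intros c Hcab. apply (continuity_pt_clamp X f b c); auto; lra.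
  - intros c _. apply derivable_continuous_pt, derivable_pt_id.
  - exists c; split; [exact P |].
    rewrite derive_pt_id in Hmvt. unfold id, derive_pt in Hmvt; simpl in Hmvt.
    unfold g in Hmvt. rewrite !Rmax_right in Hmvt by lra. lra.
Qed.

Lemma Ico_incr (X : Rbar) (f f1 : R -> R) (a b : R) :
  Rbar_lt 0 X -> continuous_on (Ico X) f ->
  (forall r, Ioo X r -> is_derive f r (f1 r)) ->
  (forall r, Ioo X r -> 0 <= f1 r) ->
  0 <= a <= b -> Ico X b -> f a <= f b.
Proof.
  intros HX Hc Hd Hp Hab Hb.
  destruct (Req_dec a b) as [<- | Hne]; [lra |].
  destruct (MVT_Ico X f f1 a b HX Hc Hd ltac:(lra) Hb) as (c & Hcab & E).
  assert (0 <= f1 c) by (apply Hp, (Ioo_le X c b Hb); lra).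
  nra.
Qed.

Lemma Ico_const (X : Rbar) (f : R -> R) (r : R) :
  Rbar_lt 0 X -> continuous_on (Ico X) f ->
  (forall r, Ioo X r -> is_derive f r 0) -> Ico X r -> f r = f 0.
Proof.
  intros HX Hc Hd Hr. destruct (Ico_cases X r Hr) as [-> | [Hr0 _]]; [easy |].
  destruct (MVT_Ico X f (fun _ => 0) 0 r HX Hc Hd ltac:(lra) Hr) as (c & _ & E).
  lra.
Qed.

Lemma is_derive_deriv_on (X : Rbar) (f f1 : R -> R) (r : R) :
  deriv_on (Ico X) f f1 -> Ioo X r -> is_derive f r (f1 r).
Proof.
  intros Hf Hr. apply is_derive_Reals. intros eps He.
  destruct (Hf r (Ioo_Ico X r Hr) eps He) as (del & Hd & Hy).
  destruct (locally_Ioo X r Hr) as [d2 Hd2].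
  exists (mkposreal _ (Rmin_stable_in_posreal (mkposreal del Hd) d2)).
  simpl. intros h Hh0 Hh.
  specialize (Hy (r + h)). simpl in Hy. unfold Rdist in Hy.
  replace (r + h - r) with h in Hy by ring. apply Hy.
  split; [split |].
  - apply Ioo_Ico, Hd2. unfold ball; simpl; unfold AbsRing_ball, abs, minus, plus, opp; simpl.
    replace (r + h + - r) with h by ring.
    apply Rlt_le_trans with (1 := Hh), Rmin_r.
  - lra.
  - apply Rlt_le_trans with (1 := Hh), Rmin_l.
Qed.

Lemma deriv_on_continuous (X : Rbar) (f f1 : R -> R) :
  deriv_on (Ico X) f f1 -> continuous_on (Ico X) f.
Proof.
  intros H r Hr. apply (cont_deriv f f1). apply H, Hr.
Qed.

(** By the mean value theorem a continuous extension of the derivative to [0]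
    is automatically the one-sided derivative there; hence only interior
    derivatives have to be computed. *)
Lemma deriv_on_of_interior (X : Rbar) (f f1 : R -> R) :
  Rbar_lt 0 X -> continuous_on (Ico X) f -> continuous_on (Ico X) f1 ->
  (forall r, Ioo X r -> is_derive f r (f1 r)) -> deriv_on (Ico X) f f1.
Proof.
  intros HX Hf Hf1 Hd r Hr eps He.
  destruct (Ico_cases X r Hr) as [-> | Hr0].
  - destruct (proj1 (continue_in_eps f1 (Ico X) 0) (Hf1 0 Hr) eps He)
      as (del & Hdel & Hy).
    exists del; split; [exact Hdel |].
    simpl; unfold Rdist. intros y [[Dy Hne] Hy0].
    destruct (MVT_Ico X f f1 0 y HX Hf Hd) as (c & Hc & E);
      [destruct Dy; lra | exact Dy |].
    rewrite E. replace (f1 c * (y - 0) / (y - 0)) with (f1 c) by (field; lra).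
    apply Hy; [apply (Ico_le X c y Dy); lra |].
    rewrite Rabs_pos_eq in * by lra. lra.
  - destruct (proj1 (is_derive_Reals f r (f1 r)) (Hd r Hr0) eps He) as [del Hdel].
    exists del; split; [apply cond_pos |].
    simpl; unfold Rdist. intros y [[Dy Hne] Hy0].
    specialize (Hdel (y - r)). replace (r + (y - r)) with y in Hdel by ring.
    apply Hdel; [lra | exact Hy0].
Qed.

Lemma deriv_on_unique (X : Rbar) (f g f1 g1 : R -> R) (r : R) :
  deriv_on (Ico X) f f1 -> eq_on (Ico X) f g ->
  is_derive g r (g1 r) -> Ioo X r -> f1 r = g1 r.
Proof.
  intros Hf Hfg Hg Hr.
  rewrite <- (is_derive_unique g r (g1 r) Hg).
  symmetry; apply is_derive_unique.
  apply (is_derive_ext_loc f).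
  - generalize (locally_Ioo X r Hr). apply filter_imp.
    intros y Hy; apply Hfg, Ioo_Ico, Hy.
  - apply (is_derive_deriv_on X); assumption.
Qed.

Lemma continuous_on_plus (D : R -> Prop) (f g : R -> R) :
  continuous_on D f -> continuous_on D g -> continuous_on D (fun r => f r + g r).
Proof. intros Hf Hg r Hr. apply limit_plus; [apply Hf | apply Hg]; exact Hr. Qed.

Lemma continuous_on_mult (D : R -> Prop) (f g : R -> R) :
  continuous_on D f -> continuous_on D g -> continuous_on D (fun r => f r * g r).
Proof. intros Hf Hg r Hr. apply limit_mul; [apply Hf | apply Hg]; exact Hr. Qed.

Lemma continuous_on_comp (D : R -> Prop) (h f : R -> R) :
  (forall r, D r -> continuous h (f r)) ->
  continuous_on D f -> continuous_on D (fun r => h (f r)).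
Proof.
  intros Hh Hf r Hr. apply continue_in_eps. intros eps He.
  destruct (proj1 (filterlim_locally h (h (f r))) (Hh r Hr) (mkposreal eps He))
    as [d1 Hd1].
  destruct (proj1 (continue_in_eps f D r) (Hf r Hr) d1 (cond_pos d1))
    as (d2 & Hd2 & Hy).
  exists d2; split; [exact Hd2 |]. intros y Dy Hyr.
  exact (Hd1 _ (Hy y Dy Hyr)).
Qed.

Lemma continuous_on_continuous (D : R -> Prop) (f : R -> R) :
  (forall r, continuous f r) -> continuous_on D f.
Proof. intros H r _. apply continuous_continue_in, H. Qed.

Lemma continuous_on_const (D : R -> Prop) (c : R) : continuous_on D (fun _ => c).
Proof. apply continuous_on_continuous; intros r; apply continuous_const. Qed.

Lemma continuous_on_id (D : R -> Prop) : continuous_on D (fun r => r).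
Proof. apply continuous_on_continuous; intros r; apply continuous_id. Qed.

Lemma continuous_on_opp (D : R -> Prop) (f : R -> R) :
  continuous_on D f -> continuous_on D (fun r => - f r).
Proof. intros Hf r Hr. apply limit_Ropp, Hf, Hr. Qed.

Lemma continuous_on_minus (D : R -> Prop) (f g : R -> R) :
  continuous_on D f -> continuous_on D g -> continuous_on D (fun r => f r - g r).
Proof.
  intros Hf Hg. apply continuous_on_plus; [exact Hf |].
  apply continuous_on_opp, Hg.
Qed.

Lemma continuous_on_pow (D : R -> Prop) (f : R -> R) (n : nat) :
  continuous_on D f -> continuous_on D (fun r => f r ^ n).
Proof.
  intros Hf; induction n as [| n IH]; simpl.
  - apply continuous_on_const.
  - apply continuous_on_mult; assumption.
Qed.

Lemma continuous_on_div (D : R -> Prop) (f g : R -> R) :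
  (forall r, D r -> g r <> 0) ->
  continuous_on D f -> continuous_on D g -> continuous_on D (fun r => f r / g r).
Proof.
  intros Hg0 Hf Hg. apply continuous_on_mult; [exact Hf |].
  intros r Hr. apply limit_inv; [apply Hg, Hr | apply Hg0, Hr].
Qed.

(** Division is tried before the product: [f / g] unfolds to a product whose
    second factor is out of reach of the other rules. *)
Ltac cont_on :=
  repeat (assumption || apply continuous_on_const || apply continuous_on_id ||
          apply continuous_on_minus || apply continuous_on_plus ||
          apply continuous_on_div || apply continuous_on_mult ||
          apply continuous_on_opp || apply continuous_on_pow).

Lemma continuous_on_interior (X : Rbar) (f : R -> R) :
  continuous_on (Ico X) f -> continuous_on (Ioo X) f.
Proof.
  intros H r Hr. apply continue_in_subset with (E := Ico X).
  - apply Ioo_Ico.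
  - apply H, Ioo_Ico, Hr.
Qed.

(** For functions with a singular-looking formula at [0], where the value
    produced by total division is the limit. *)
Lemma continuous_on_of_bound (X : Rbar) (f : R -> R) (K del : R) :
  continuous_on (Ioo X) f -> f 0 = 0 -> 0 < del ->
  (forall r, Ioo X r -> r < del -> Rabs (f r) <= K * r) ->
  continuous_on (Ico X) f.
Proof.
  intros Hf Hf0 Hdel Hb r Hr. destruct (Ico_cases X r Hr) as [-> | Hr0].
  - apply continue_in_eps. intros eps He.
    assert (HK : 0 < Rabs K + 1) by (generalize (Rabs_pos K); lra).
    exists (Rmin del (eps / (Rabs K + 1))). split.
    { apply Rmin_pos; [exact Hdel | apply Rdiv_lt_0_compat; lra]. }
    intros y Dy Hy. rewrite Hf0, Rminus_0_r in *.
    destruct (Ico_cases X y Dy) as [-> | Hy0].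
    { rewrite Hf0, Rabs_R0; exact He. }
    assert (0 < y) by apply Hy0.
    rewrite (Rabs_pos_eq y) in Hy by lra.
    apply Rle_lt_trans with (1 := Hb y Hy0 (Rlt_le_trans _ _ _ Hy (Rmin_l _ _))).
    apply Rle_lt_trans with ((Rabs K + 1) * y).
    + apply Rmult_le_compat_r; [lra |]. generalize (Rle_abs K); lra.
    + apply Rlt_le_trans with ((Rabs K + 1) * (eps / (Rabs K + 1))).
      * apply Rmult_lt_compat_l; [exact HK |].
        apply Rlt_le_trans with (1 := Hy), Rmin_r.
      * right; field; lra.
  - apply continuous_continue_in, (continuous_interior X); assumption.
Qed.

(** The clamped integrand is continuous on all of [(-oo, X)], which gives a
    primitive that is differentiable, hence continuous, at [0] too. *)
Lemma primitive_Ico (X : Rbar) (f : R -> R) :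
  Rbar_lt 0 X -> continuous_on (Ico X) f ->
  exists F, F 0 = 0 /\ continuous_on (Ico X) F /\
    forall r, Ioo X r -> is_derive F r (f r).
Proof.
  intros HX Hf.
  exists (fun r => RInt (fun s => f (Rmax 0 s)) 0 r).
  assert (H : forall r, Ico X r ->
    is_derive (fun r => RInt (fun s => f (Rmax 0 s)) 0 r) r (f (Rmax 0 r))).
  { intros r [Hr HrX].
    apply (is_derive_RInt (fun s => f (Rmax 0 s)) _ 0 r).
    - generalize (open_Rbar_lt X r HrX). apply filter_imp. intros b Hb.
      apply (RInt_correct (V := R_CompleteNormedModule)).
      apply (ex_RInt_continuous (V := R_CompleteNormedModule)). intros s Hs.
      apply (continuous_clamp X f s HX Hf).
      unfold Rmin, Rmax in Hs. destruct (Rle_dec 0 b).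
      + apply (Rbar_le_lt_trans s b X); [simpl; lra | exact Hb].
      + apply (Rbar_le_lt_trans s 0 X); [simpl; lra | exact HX].
    - apply (continuous_clamp X f r HX Hf HrX). }
  split; [exact (RInt_point 0 _) |]. split.
  - intros r Hr. apply continuous_continue_in.
    apply (ex_derive_continuous (V := R_NormedModule)).
    eexists; apply H, Hr.
  - intros r Hr. specialize (H r (Ioo_Ico X r Hr)).
    rewrite Rmax_right in H by (destruct Hr; lra). exact H.
Qed.

(** The mean value theorem on both sides of the intermediate point: the two
    slopes are values of the derivative at ordered points. *)
Lemma strictly_convex_of_deriv (X : Rbar) (f f1 : R -> R) :
  Rbar_lt 0 X -> continuous_on (Ico X) f ->
  (forall r, Ioo X r -> is_derive f r (f1 r)) ->
  (forall r s, Ioo X s -> 0 < r < s -> f1 r < f1 s) ->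
  strictly_convex_on (Ico X) f.
Proof.
  intros HX Hf Hd Hi.
  assert (H : forall x y t, Ico X x -> Ico X y -> x < y -> 0 < t < 1 ->
    f (t * x + (1 - t) * y) < t * f x + (1 - t) * f y).
  { intros x y t Hx Hy Hxy Ht. set (c := t * x + (1 - t) * y).
    assert (Hxc : c - x = (1 - t) * (y - x)) by (unfold c; ring).
    assert (Hcy : y - c = t * (y - x)) by (unfold c; ring).
    assert (0 < (1 - t) * (y - x)) by (apply Rmult_lt_0_compat; lra).
    assert (0 < t * (y - x)) by (apply Rmult_lt_0_compat; lra).
    assert (0 <= x) by apply Hx.
    destruct (MVT_Ico X f f1 x c HX Hf Hd) as (p & Hp & Ep);
      [lra | apply (Ico_le X c y Hy); lra |].
    destruct (MVT_Ico X f f1 c y HX Hf Hd) as (q & Hq & Eq); [lra | exact Hy |].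
    assert (Hpq : f1 p < f1 q)
      by (apply Hi; [apply (Ioo_le X q y Hy) |]; lra).
    rewrite Hxc in Ep. rewrite Hcy in Eq.
    assert (0 < t * (1 - t) * (y - x) * (f1 q - f1 p)).
    { repeat apply Rmult_lt_0_compat; lra. }
    nra. }
  intros x y t Hx Hy Hxy Ht. destruct (Rlt_le_dec x y).
  - apply H; assumption.
  - generalize (H y x (1 - t) Hy Hx ltac:(lra) ltac:(lra)).
    replace (1 - (1 - t)) with t by ring.
    replace ((1 - t) * y + t * x) with (t * x + (1 - t) * y) by ring. lra.
Qed.

Lemma strictly_concave_of_deriv (X : Rbar) (f f1 : R -> R) :
  Rbar_lt 0 X -> continuous_on (Ico X) f ->
  (forall r, Ioo X r -> is_derive f r (f1 r)) ->
  (forall r s, Ioo X s -> 0 < r < s -> f1 s < f1 r) ->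
  strictly_concave_on (Ico X) f.
Proof.
  intros HX Hf Hd Hi x y t Hx Hy Hxy Ht.
  generalize (strictly_convex_of_deriv X (fun r => - f r) (fun r => - f1 r) HX
    (continuous_on_opp _ _ Hf)
    (fun r Hr => is_derive_opp (V := R_NormedModule) f r (f1 r) (Hd r Hr))
    (fun r s Hs Hrs => Ropp_lt_contravar _ _ (Hi r s Hs Hrs))
    x y t Hx Hy Hxy Ht).
  lra.
Qed.

(** * The linear radial equation *)

(** Solutions of [u'' + (n / r) u' = W u] with [u(0) = 1], [u'(0) = 0], where
    [n] is the space dimension minus one. The second derivative appears only in
    the interior, where the equation can be solved for it. *)
Definition radial_sol (X : Rbar) (n : nat) (W u u1 : R -> R) : Prop :=
  continuous_on (Ico X) u /\ continuous_on (Ico X) u1 /\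
  (forall r, Ioo X r -> is_derive u r (u1 r)) /\
  (forall r, Ioo X r -> is_derive u1 r (W r * u r - INR n / r * u1 r)) /\
  u 0 = 1 /\ u1 0 = 0.

(** The weight [r ^ n] is the integrating factor of [f' + (n / r) f]; every
    argument below applies this to a suitable combination of [u] and [u']. *)
Lemma is_derive_flux (n : nat) (f : R -> R) (r l : R) :
  0 < r -> is_derive f r l ->
  is_derive (fun s => s ^ n * f s) r (r ^ n * (l + INR n / r * f r)).
Proof.
  intros Hr Hf.
  replace (r ^ n * (l + INR n / r * f r))
    with (INR n * 1 * r ^ pred n * f r + r ^ n * l).
  - apply (is_derive_mult (fun s => s ^ n) f r).
    + apply (is_derive_pow (fun s => s)), is_derive_Reals, derivable_pt_lim_id.
    + exact Hf.
    + exact Rmult_comm.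
  - destruct n as [| n]; [simpl; field; lra |].
    simpl pred. rewrite <- tech_pow_Rmult. field; lra.
Qed.

(** The weighted product [r ^ n u u'] has derivative [r ^ n (u' ^ 2 + W u ^ 2)]
    and vanishes at [0]. Working with [u u'] instead of [u'] requires no prior
    knowledge of the sign of [u]. *)
Lemma radial_energy (X : Rbar) (n : nat) (W u u1 : R -> R) :
  Rbar_lt 0 X -> (forall r, Ioo X r -> 0 <= W r) -> radial_sol X n W u u1 ->
  forall r, Ioo X r -> 0 <= u r * u1 r.
Proof.
  intros HX HW (Cu & Cu1 & Du & Du1 & U0 & U10) r Hr.
  assert (H : 0 ^ n * (u 0 * u1 0) <= r ^ n * (u r * u1 r)).
  { apply (Ico_incr X (fun s => s ^ n * (u s * u1 s))
      (fun s => s ^ n * (u1 s * u1 s + u s * (W s * u s - INR n / s * u1 s)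
                         + INR n / s * (u s * u1 s)))); auto.
    - cont_on.
    - intros s Hs. apply (is_derive_flux n (fun r => u r * u1 r)); [apply Hs |].
      apply (is_derive_mult u u1 s); auto. exact Rmult_comm.
    - intros s Hs. apply Rmult_le_pos; [apply pow_le; left; apply Hs |].
      replace (u1 s * u1 s + u s * (W s * u s - INR n / s * u1 s)
               + INR n / s * (u s * u1 s))
        with (u1 s * u1 s + W s * (u s * u s)) by ring.
      generalize (HW s Hs); nra.
    - split; [lra | left; apply Hr].
    - apply Ioo_Ico, Hr. }
  rewrite U10 in H.
  assert (0 < r ^ n) by (apply pow_lt, Hr).
  nra.
Qed.

(** By the energy inequality [u ^ 2] is nondecreasing, so [u] stays outside
    [(-1, 1)]; being continuous with [u(0) = 1] it cannot change sign. *)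
Lemma radial_ge_1 (X : Rbar) (n : nat) (W u u1 : R -> R) :
  Rbar_lt 0 X -> (forall r, Ioo X r -> 0 <= W r) -> radial_sol X n W u u1 ->
  forall r, Ico X r -> 1 <= u r.
Proof.
  intros HX HW S. generalize (radial_energy X n W u u1 HX HW S); intros E.
  destruct S as (Cu & Cu1 & Du & Du1 & U0 & U10).
  assert (Sq : forall r, Ico X r -> 1 <= u r * u r).
  { intros r Hr. replace 1 with (u 0 * u 0) by (rewrite U0; ring).
    apply (Ico_incr X (fun s => u s * u s) (fun s => u1 s * u s + u s * u1 s)); auto.
    - cont_on.
    - intros s Hs. apply (is_derive_mult u u s); auto. exact Rmult_comm.
    - intros s Hs. generalize (E s Hs); lra.
    - split; [lra | apply Hr]. }
  intros r Hr. generalize (Sq r Hr); intros Hsq.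
  destruct (Rlt_le_dec (u r) 0) as [Hneg | Hpos]; [| nra].
  exfalso.
  assert (Hr0 : 0 < r) by (destruct (Ico_cases X r Hr) as [-> | Hr0]; [lra | apply Hr0]).
  destruct (IVT_interv (fun s => - u (Rmax 0 s)) 0 r) as (s & Hs & Es).
  - intros c Hc. apply continuity_pt_opp.
    apply (continuity_pt_clamp X u r c HX Cu Hr); lra.
  - exact Hr0.
  - rewrite Rmax_left by lra. lra.
  - rewrite Rmax_right by lra. lra.
  - rewrite Rmax_right in Es by lra.
    generalize (Sq s (Ico_le X s r Hr ltac:(lra))). nra.
Qed.

Lemma radial_deriv_nonneg (X : Rbar) (n : nat) (W u u1 : R -> R) :
  Rbar_lt 0 X -> (forall r, Ioo X r -> 0 <= W r) -> radial_sol X n W u u1 ->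
  forall r, Ioo X r -> 0 <= u1 r.
Proof.
  intros HX HW S r Hr.
  generalize (radial_energy X n W u u1 HX HW S r Hr)
    (radial_ge_1 X n W u u1 HX HW S r (Ioo_Ico X r Hr)). nra.
Qed.

(** The weighted Wronskian [r ^ n (u v' - u' v)] is constant, hence zero, so
    [v / u] is constant, because [u] has no zero. *)
Lemma radial_unique (X : Rbar) (n : nat) (W u u1 v v1 : R -> R) :
  Rbar_lt 0 X -> (forall r, Ioo X r -> 0 <= W r) ->
  radial_sol X n W u u1 -> radial_sol X n W v v1 -> eq_on (Ico X) v u.
Proof.
  intros HX HW Su Sv.
  generalize (radial_ge_1 X n W u u1 HX HW Su); intros U.
  destruct Su as (Cu & Cu1 & Du & Du1 & U0 & U10).
  destruct Sv as (Cv & Cv1 & Dv & Dv1 & V0 & V10).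
  assert (Wr : forall r, Ioo X r -> u r * v1 r - u1 r * v r = 0).
  { intros r Hr.
    assert (H : r ^ n * (u r * v1 r - u1 r * v r) = 0 ^ n * (u 0 * v1 0 - u1 0 * v 0)).
    { apply (Ico_const X (fun r => r ^ n * (u r * v1 r - u1 r * v r))); auto.
      - cont_on.
      - intros s Hs.
        replace 0 with (s ^ n *
          ((u1 s * v1 s + u s * (W s * v s - INR n / s * v1 s)) -
           ((W s * u s - INR n / s * u1 s) * v s + u1 s * v1 s)
           + INR n / s * (u s * v1 s - u1 s * v s))) by ring.
        apply (is_derive_flux n (fun r => u r * v1 r - u1 r * v r)); [apply Hs |].
        apply (is_derive_minus (V := R_NormedModule)).
        + apply (is_derive_mult u v1 s); auto. exact Rmult_comm.
        + apply (is_derive_mult u1 v s); auto. exact Rmult_comm.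
      - apply Ioo_Ico, Hr. }
    rewrite U10, V10 in H.
    assert (0 < r ^ n) by (apply pow_lt, Hr).
    nra. }
  intros r Hr.
  assert (H : v r / u r = v 0 / u 0).
  { apply (Ico_const X (fun r => v r / u r)); auto.
    - cont_on. intros s Hs; generalize (U s Hs); lra.
    - intros s Hs. generalize (U s (Ioo_Ico X s Hs)); intros Us.
      replace 0 with ((v1 s * u s - v s * u1 s) / u s ^ 2).
      + apply is_derive_div; auto; lra.
      + replace (v1 s * u s - v s * u1 s) with 0 by (generalize (Wr s Hs); lra).
        field; lra. }
  rewrite U0, V0 in H. generalize (U r Hr); intros Ur.
  replace (v r) with (v r / u r * u r) by (field; lra).
  rewrite H. field.
Qed.

(** If [W = O(r ^ 2)] then [(r ^ n u')' = r ^ n W u = O(r ^ (n + 2))], and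
    integrating gives [u' = O(r ^ 3)]. *)
Lemma radial_deriv_small (X : Rbar) (n : nat) (W u u1 : R -> R) (K del : R) :
  Rbar_lt 0 X -> (forall r, Ioo X r -> 0 <= W r) -> radial_sol X n W u u1 ->
  0 < del -> (forall r, Ioo X r -> r < del -> W r <= K * r ^ 2) ->
  exists K' del', 0 <= K' /\ 0 < del' /\
    forall r, Ioo X r -> r < del' -> u1 r <= K' * r ^ 3.
Proof.
  intros HX HW S Hdel HK.
  generalize (radial_ge_1 X n W u u1 HX HW S); intros U.
  destruct S as (Cu & Cu1 & Du & Du1 & U0 & U10).
  destruct (proj1 (continue_in_eps u (Ico X) 0) (Cu 0 (Ico_0 X HX)) 1 Rlt_0_1)
    as (d & Hd & Hu).
  set (K0 := Rabs K). assert (HK0 : 0 <= K0) by apply Rabs_pos.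
  (* With [u <= 2] near [0], [(r ^ n u')' <= 2 K0 r ^ (n + 2)], which is at most
     the derivative of [2 K0 r ^ (n + 3)]. *)
  exists (2 * K0), (Rmin del d). split; [lra |].
  split; [apply Rmin_pos; assumption |].
  intros r Hr Hrd.
  assert (Hr0 : 0 < r) by apply Hr.
  assert (Hrd1 := Rlt_le_trans _ _ _ Hrd (Rmin_l _ _)).
  assert (Hrd2 := Rlt_le_trans _ _ _ Hrd (Rmin_r _ _)).
  destruct (MVT_Ico X (fun s => s ^ n * (u1 s - 2 * K0 * s ^ 3))
    (fun s => s ^ n * ((W s * u s - INR n / s * u1 s) - 2 * K0 * (3 * s ^ 2)
       + INR n / s * (u1 s - 2 * K0 * s ^ 3))) 0 r) as (s & Hs & E); auto.
  - cont_on.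
  - intros s Hs. apply (is_derive_flux n (fun s => u1 s - 2 * K0 * s ^ 3));
      [apply Hs |].
    apply (is_derive_minus (V := R_NormedModule)); [auto |].
    auto_derive; [trivial | ring].
  - lra.
  - apply Ioo_Ico, Hr.
  - rewrite U10, (pow_i 3), Rmult_0_r, Rminus_0_r, Rmult_0_r, !Rminus_0_r in E by lia.
    assert (Hs' : Ioo X s) by (apply (Ioo_le X s r); [apply Ioo_Ico |]; [assumption | lra]).
    assert (B : W s * u s - 2 * K0 * (3 * s ^ 2) - 2 * K0 * (INR n * s ^ 2) <= 0).
    { assert (u s <= 2).
      { assert (Hus : Rabs (u s - u 0) < 1)
          by (apply Hu; [apply Ioo_Ico, Hs' | rewrite Rminus_0_r, Rabs_pos_eq; lra]).
        apply Rabs_def2 in Hus; lra. }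
      assert (W s <= K0 * s ^ 2).
      { apply Rle_trans with (K * s ^ 2); [apply HK; [exact Hs' | lra] |].
        apply Rmult_le_compat_r; [apply pow2_ge_0 | apply Rle_abs]. }
      generalize (U s (Ioo_Ico X s Hs')) (HW s Hs') (pos_INR n) (pow2_ge_0 s).
      intros.
      assert (0 <= K0 * s ^ 2) by (apply Rmult_le_pos; assumption).
      assert (0 <= K0 * s ^ 2 * INR n) by (apply Rmult_le_pos; assumption).
      nra. }
    replace (W s * u s - INR n / s * u1 s - 2 * K0 * (3 * s ^ 2)
             + INR n / s * (u1 s - 2 * K0 * s ^ 3))
      with (W s * u s - 2 * K0 * (3 * s ^ 2) - 2 * K0 * (INR n * s ^ 2)) in E
      by (field; lra).
    assert (0 <= s ^ n) by (apply pow_le; lra).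
    assert (0 < r ^ n) by (apply pow_lt; lra).
    assert (r ^ n * (u1 r - 2 * K0 * r ^ 3) <= 0).
    { rewrite E. assert (0 <= s ^ n * r) by (apply Rmult_le_pos; lra). nra. }
    nra.
Qed.

(** The logarithmic derivative [v = u' / u] solves [v' = W - v ^ 2 - (n / r) v].
    Suppose [v'(r0) <= 0] and put [m = v(r0) > 0]. For [s < r0] both [W(s)] and
    [- (n / s) m] are at most their values at [r0], so the constant [m] stays a
    supersolution of the equation of [v] on [(0, r0)], and then [v >= m] there,
    against [v -> 0] at [0]. *)
Lemma radial_log_deriv_incr (X : Rbar) (n : nat) (W u u1 : R -> R) :
  Rbar_lt 0 X -> (forall r, Ioo X r -> 0 <= W r) -> radial_sol X n W u u1 ->
  (forall r, Ioo X r -> 0 < u1 r) -> nondecreasing_on (Ioo X) W ->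
  forall r s, Ioo X s -> 0 < r < s -> u1 r / u r < u1 s / u s.
Proof.
  intros HX HW S Hu1 HWi.
  generalize (radial_ge_1 X n W u u1 HX HW S); intros U.
  destruct S as (Cu & Cu1 & Du & Du1 & U0 & U10).
  assert (Key : forall r, Ioo X r ->
    0 < W r - (u1 r / u r) ^ 2 - INR n / r * (u1 r / u r)).
  { intros r0 Hr0. apply Rnot_le_lt. intros Hneg.
    set (m := u1 r0 / u r0) in *.
    assert (Hr0p : 0 < r0) by apply Hr0.
    assert (Hm : 0 < m).
    { generalize (U r0 (Ioo_Ico X r0 Hr0)) (Hu1 r0 Hr0). intros.
      apply Rdiv_lt_0_compat; lra. }
    destruct (proj1 (continue_in_eps (fun r => u1 r - m * u r) (Ico X) 0)) with (eps := m)
      as (d & Hd & Hnear); [| exact Hm |].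
    { assert (C : continuous_on (Ico X) (fun r => u1 r - m * u r)) by cont_on.
      apply C, Ico_0, HX. }
    set (r := Rmin (d / 2) (r0 / 2)).
    assert (Hrp : 0 < r) by (apply Rmin_pos; lra).
    assert (r <= d / 2) by apply Rmin_l. assert (r <= r0 / 2) by apply Rmin_r.
    assert (Hr : Ico X r) by (apply (Ico_le X r r0); [apply Ioo_Ico, Hr0 | lra]).
    assert (Hlt : u1 r - m * u r < 0).
    { assert (Hb : Rabs (u1 r - m * u r - (u1 0 - m * u 0)) < m).
      { apply Hnear; [exact Hr | rewrite Rminus_0_r, Rabs_pos_eq; lra]. }
      apply Rabs_def2 in Hb. rewrite U10, U0 in Hb. lra. }
    assert (E0 : u1 r0 - m * u r0 = 0).
    { unfold m. field. generalize (U r0 (Ioo_Ico X r0 Hr0)); lra. }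
    (* [u' - m u = u (v - m)], and [s ^ n exp (m s) u] is the integrating factor
       of [(v - m)' <= - (v - m) (v + m + n / s)], since [u = exp (int v)]. *)
    destruct (MVT_Ico X (fun s => s ^ n * (exp (m * s) * (u1 s - m * u s)))
      (fun s => s ^ n * (m * exp (m * s) * (u1 s - m * u s)
         + exp (m * s) * ((W s * u s - INR n / s * u1 s) - m * u1 s)
         + INR n / s * (exp (m * s) * (u1 s - m * u s)))) r r0)
      as (s & Hs & E); auto.
    - cont_on. apply (continuous_on_continuous _ (fun r => exp (m * r))). intros s.
      apply (ex_derive_continuous (V := R_NormedModule)). auto_derive; trivial.
    - intros s Hs.
      apply (is_derive_flux n (fun s => exp (m * s) * (u1 s - m * u s))); [apply Hs |].
      apply (is_derive_mult (fun s => exp (m * s)) (fun s => u1 s - m * u s) s);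
        [auto_derive; [trivial | ring] | | exact Rmult_comm].
      apply (is_derive_minus (V := R_NormedModule)); [auto |].
      apply (is_derive_scal u s m (u1 s)); auto.
    - lra.
    - apply Ioo_Ico, Hr0.
    - rewrite E0, !Rmult_0_r, Rminus_0_l in E.
      replace (m * exp (m * s) * (u1 s - m * u s)
         + exp (m * s) * ((W s * u s - INR n / s * u1 s) - m * u1 s)
         + INR n / s * (exp (m * s) * (u1 s - m * u s)))
        with (exp (m * s) * (u s * (W s - m ^ 2 - INR n / s * m))) in E
        by (field; lra).
      assert (Hs' : Ioo X s) by (apply (Ioo_le X s r0); [apply Ioo_Ico, Hr0 | lra]).
      assert (Hws : W s - m ^ 2 - INR n / s * m <= 0).
      { apply Rle_trans with (2 := Hneg).
        assert (W s <= W r0) by (apply HWi; auto; lra).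
        assert (INR n / r0 <= INR n / s).
        { apply Rmult_le_compat_l; [apply pos_INR | apply Rinv_le_contravar; lra]. }
        assert (INR n / r0 * m <= INR n / s * m) by (apply Rmult_le_compat_r; lra).
        lra. }
      generalize (U s (Ioo_Ico X s Hs')); intros Us.
      assert (0 < r ^ n * (exp (m * r) * - (u1 r - m * u r))).
      { repeat apply Rmult_lt_0_compat; [apply pow_lt, Hrp | apply exp_pos | lra]. }
      assert (0 <= s ^ n * (exp (m * s) * (u s * - (W s - m ^ 2 - INR n / s * m)))
                     * (r0 - r)).
      { repeat apply Rmult_le_pos; try lra; [apply pow_le; lra | left; apply exp_pos]. }
      lra. }
  intros r s Hs Hrs.
  destruct (MVT_Ico X (fun s => u1 s / u s)
    (fun r => W r - (u1 r / u r) ^ 2 - INR n / r * (u1 r / u r)) r s)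
    as (c & Hc & E); auto.
  - cont_on. intros c Hc; generalize (U c Hc); lra.
  - intros c Hc. generalize (U c (Ioo_Ico X c Hc)); intros Uc.
    assert (0 < c) by apply Hc.
    replace (W c - (u1 c / u c) ^ 2 - INR n / c * (u1 c / u c))
      with (((W c * u c - INR n / c * u1 c) * u c - u1 c * u1 c) / u c ^ 2)
      by (field; lra).
    apply is_derive_div; auto; lra.
  - lra.
  - apply Ioo_Ico, Hs.
  - assert (0 < W c - (u1 c / u c) ^ 2 - INR n / c * (u1 c / u c)).
    { apply Key. apply (Ioo_le X c s); [apply Ioo_Ico, Hs | lra]. }
    nra.
Qed.

(** * Barriers at infinity *)

(** Above the level [M] the function decreases at a definite rate, so it gets
    below [M] at some point; it cannot exceed [M] later, since at a maximum
    point above [M] the derivative would have to be nonnegative. *)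
Lemma eventually_le_of_barrier (f f1 : R -> R) (r0 M c : R) :
  0 < c ->
  (forall r, r0 <= r -> is_derive f r (f1 r)) ->
  (forall r, r0 <= r -> M <= f r -> f1 r <= - c) ->
  exists r1, forall r, r1 <= r -> f r <= M.
Proof.
  intros Hc Hd Hb.
  assert (Hcont : forall r, r0 <= r -> continuity_pt f r).
  { intros r Hr. apply derivable_continuous_pt. exists (f1 r).
    apply is_derive_Reals, Hd, Hr. }
  assert (H1 : exists r1, r0 <= r1 /\ f r1 <= M).
  { set (T := r0 + (Rabs (f r0 - M) + 1) / c).
    assert (0 < (Rabs (f r0 - M) + 1) / c)
      by (apply Rdiv_lt_0_compat; [generalize (Rabs_pos (f r0 - M)) |]; lra).
    destruct (MVT_cor2 f f1 r0 T) as (p & E & Hp).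
    - unfold T; lra.
    - intros x Hx. apply is_derive_Reals, Hd; lra.
    - destruct (Rle_lt_dec (f p) M); [exists p; split; lra |].
      destruct (Rle_lt_dec (f T) M) as [| HT]; [exists T; split; unfold T in *; lra |].
      exfalso. assert (f1 p <= - c) by (apply Hb; lra).
      assert (Hc' : c * (T - r0) = Rabs (f r0 - M) + 1) by (unfold T; field; lra).
      assert (0 < T - r0) by (unfold T; lra).
      generalize (Rle_abs (f r0 - M)). nra. }
  destruct H1 as (r1 & Hr1 & Hf1). exists r1. intros r Hr.
  apply Rnot_lt_le; intros HM.
  destruct (continuity_ab_maj f r1 r Hr) as (p & Hmax & Hp).
  { intros x Hx; apply Hcont; lra. }
  assert (f r <= f p) by (apply Hmax; lra).
  assert (Hp1 : r1 < p) by (destruct (Rle_lt_or_eq_dec r1 p) as [| <-]; lra).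
  assert (Hneg : f1 p <= - c) by (apply Hb; lra).
  destruct (proj1 (is_derive_Reals f p (f1 p)) (Hd p ltac:(lra)) c Hc) as [d Hdel].
  set (h := Rmin (d / 2) (p - r1)).
  assert (0 < d) by apply cond_pos.
  assert (0 < h) by (apply Rmin_pos; lra).
  assert (h <= d / 2) by apply Rmin_l. assert (h <= p - r1) by apply Rmin_r.
  assert (Hq : Rabs ((f (p + - h) - f p) / - h - f1 p) < c)
    by (apply Hdel; [lra | rewrite Rabs_Ropp, Rabs_pos_eq; lra]).
  assert (0 <= (f (p + - h) - f p) / - h).
  { replace ((f (p + - h) - f p) / - h) with ((f p - f (p + - h)) / h) by (field; lra).
    apply Rle_mult_inv_pos; [| lra].
    assert (f (p + - h) <= f p) by (apply Hmax; lra). lra. }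
  apply Rabs_def2 in Hq. lra.
Qed.

(** Since [q -> l ^ 2], a value of [phi] above [l + e] or below [l - e] makes
    [r (q - phi ^ 2)] at least of order [r], with the sign that drives [phi] back, and the
    damping term [(N / r) phi] is helpful in the first case and bounded in the
    second. *)
Lemma riccati_limit (N : nat) (q phi : R -> R) (l : R) :
  0 < l -> is_lim q p_infty (l ^ 2) ->
  (forall r, 0 < r -> 0 <= phi r) ->
  (forall r, 0 < r -> is_derive phi r (r * (q r - phi r ^ 2) - INR N / r * phi r)) ->
  is_lim phi p_infty l.
Proof.
  intros Hl Hq Hphi Hd. apply is_lim_spec. intros eps. simpl.
  apply is_lim_spec in Hq. simpl in Hq.
  assert (He := cond_pos eps).
  (* [e <= l] ensures [l ^ 2 - (l - e) ^ 2 >= l e] at the lower barrier. *)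
  set (e := Rmin (eps / 2) l).
  assert (0 < e) by (apply Rmin_pos; lra).
  assert (e <= eps / 2) by apply Rmin_l. assert (e <= l) by apply Rmin_r.
  assert (Hup : exists r1, forall r, r1 <= r -> phi r <= l + e).
  { destruct (Hq (mkposreal (e ^ 2) ltac:(apply pow_lt; assumption))) as (M & HM).
    simpl in HM.
    apply (eventually_le_of_barrier phi
      (fun r => r * (q r - phi r ^ 2) - INR N / r * phi r) (Rmax 1 (M + 1)) (l + e)
      (2 * l * e)).
    - nra.
    - intros r Hr. generalize (Rmax_l 1 (M + 1)); intros. apply Hd; lra.
    - intros r Hr Hb. generalize (Rmax_l 1 (M + 1)) (Rmax_r 1 (M + 1)); intros.
      assert (Hqr := HM r ltac:(lra)). apply Rabs_def2 in Hqr.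
      assert (0 <= INR N / r * phi r).
      { apply Rmult_le_pos; [apply Rle_mult_inv_pos; [apply pos_INR |] |]; lra. }
      assert (q r - phi r ^ 2 <= - (2 * l * e)) by nra.
      assert (0 < 2 * l * e) by nra.
      assert (0 <= (r - 1) * - (q r - phi r ^ 2)) by (apply Rmult_le_pos; lra).
      lra. }
  assert (Hlow : exists r2, forall r, r2 <= r -> - phi r <= - (l - e)).
  { destruct (Hq (mkposreal (l * e / 2) ltac:(nra))) as (M & HM).
    simpl in HM.
    (* Beyond [4 N / e] the damping, at most [N l], is absorbed by half of
       the driving term [r l e / 2]. *)
    set (r0 := Rmax (Rmax 1 (M + 1)) (4 * INR N / e)).
    assert (G1 : 1 <= r0) by (eapply Rle_trans; [apply Rmax_l | apply Rmax_l]).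
    assert (G2 : M + 1 <= r0) by (eapply Rle_trans; [apply Rmax_r | apply Rmax_l]).
    assert (G3 : 4 * INR N / e <= r0) by apply Rmax_r.
    apply (eventually_le_of_barrier (fun r => - phi r)
      (fun r => - (r * (q r - phi r ^ 2) - INR N / r * phi r)) r0 (- (l - e))
      (l * e / 4)).
    - nra.
    - intros r Hr. apply (is_derive_opp (V := R_NormedModule) phi). apply Hd; lra.
    - intros r Hr Hb.
      assert (Hqr := HM r ltac:(lra)). apply Rabs_def2 in Hqr.
      assert (0 <= phi r) by (apply Hphi; lra).
      assert (l * e / 2 <= q r - phi r ^ 2) by nra.
      assert (INR N / r * phi r <= INR N * l).
      { generalize (pos_INR N); intros HN.
        assert (INR N / r <= INR N).
        { apply (Rmult_le_reg_r r); [lra |].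
          replace (INR N / r * r) with (INR N) by (field; lra). nra. }
        assert (0 <= INR N / r) by (apply Rle_mult_inv_pos; lra).
        apply Rmult_le_compat; lra. }
      assert (4 * INR N <= r * e).
      { apply Rle_trans with (r0 * e); [| nra].
        replace (4 * INR N) with (4 * INR N / e * e) by (field; lra). nra. }
      assert (r * (l * e / 2) <= r * (q r - phi r ^ 2)) by nra.
      nra. }
  destruct Hup as (r1 & G1). destruct Hlow as (r2 & G2).
  exists (Rmax r1 r2). intros r Hr.
  assert (r1 <= r) by (generalize (Rmax_l r1 r2); lra).
  assert (r2 <= r) by (generalize (Rmax_r r1 r2); lra).
  generalize (G1 r ltac:(assumption)) (G2 r ltac:(assumption)); intros.
  apply Rabs_def1; lra.
Qed.

(** * Passing between the three problems *)

(* A plain repeated [split] would also introduce the quantifiers of goals such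
   as continuity on a set. *)
Ltac conj_split :=
  unfold radial_sol, C2_on;
  repeat match goal with |- _ /\ _ => split end.

Definition potential (sigma : R) (Q : R -> R) (r : R) : R := Q r / sigma ^ 4.

Lemma sol_S_radial (X : Rbar) (sigma : R) (n : nat) (Q u : R -> R) :
  regular_sol_S X sigma (S n) Q u ->
  exists u1, deriv_on (Ico X) u u1 /\ radial_sol X n (potential sigma Q) u u1.
Proof.
  intros (u1 & u2 & (Du & Du1 & Cu2) & E & U0 & U10). exists u1.
  conj_split; auto.
  - apply (deriv_on_continuous X u u1 Du).
  - apply (deriv_on_continuous X u1 u2 Du1).
  - intros r Hr. apply (is_derive_deriv_on X); assumption.
  - intros r Hr.
    replace (potential sigma Q r * u r - INR n / r * u1 r) with (u2 r).
    + apply (is_derive_deriv_on X); assumption.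
    + generalize (E r Hr). rewrite S_INR. unfold potential.
      replace (INR n + 1 - 1) with (INR n) by ring. lra.
Qed.

Lemma potential_nonneg (X : Rbar) (sigma : R) (Q : R -> R) :
  0 < sigma -> (forall r, Ico X r -> 0 <= Q r) ->
  forall r, Ioo X r -> 0 <= potential sigma Q r.
Proof.
  intros Hs HQ r Hr. apply Rle_mult_inv_pos.
  - apply HQ, Ioo_Ico, Hr.
  - apply pow_lt, Hs.
Qed.

(** The inverse of [phi = u' / (r u)] is [u = exp (int_0^r s phi(s) ds)], for
    which [u'' = (phi + r phi' + (r phi) ^ 2) u]. *)
Lemma sol_R_to_S (X : Rbar) (sigma : R) (n : nat) (Q phi : R -> R) :
  Rbar_lt 0 X -> 0 < sigma -> regular_sol_R X sigma (S n) Q phi ->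
  exists u u1, regular_sol_S X sigma (S n) Q u /\ deriv_on (Ico X) u u1 /\
    forall r, u1 r = r * phi r * u r /\ 0 < u r.
Proof.
  intros HX Hs (phi1 & (Dphi & Cphi1) & E & Phi0).
  assert (Cphi := deriv_on_continuous X phi phi1 Dphi).
  destruct (primitive_Ico X (fun r => r * phi r) HX) as (F & F0 & CF & DF); [cont_on |].
  set (u := fun r => exp (F r)).
  set (u1 := fun r => r * phi r * u r).
  set (u2 := fun r => (phi r + r * phi1 r + (r * phi r) ^ 2) * u r).
  assert (Cu : continuous_on (Ico X) u).
  { apply (continuous_on_comp _ exp F); [intros; apply continuous_exp | exact CF]. }
  assert (Cu1 : continuous_on (Ico X) u1) by (unfold u1; cont_on).
  assert (Cu2 : continuous_on (Ico X) u2) by (unfold u2; cont_on).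
  assert (Iu : forall r, Ioo X r -> is_derive u r (u1 r)).
  { intros r Hr. apply (is_derive_comp exp F r); [apply is_derive_exp | auto]. }
  assert (Iu1 : forall r, Ioo X r -> is_derive u1 r (u2 r)).
  { intros r Hr.
    replace (u2 r) with ((1 * phi r + r * phi1 r) * u r + r * phi r * u1 r)
      by (unfold u1, u2; ring).
    apply (is_derive_mult (fun r => r * phi r) u r);
      [apply (is_derive_mult (fun r => r) phi r) | |]; try exact Rmult_comm; auto.
    - apply (is_derive_id (K := R_AbsRing)).
    - apply (is_derive_deriv_on X); assumption. }
  assert (Du := deriv_on_of_interior X u u1 HX Cu Cu1 Iu).
  exists u, u1. split; [| split; [exact Du |]].
  - exists u1, u2. conj_split; auto.
    + apply deriv_on_of_interior; assumption.
    + intros r Hr. unfold u2, u1. rewrite (E r Hr). destruct Hr.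
      rewrite S_INR. field. split; lra.
    + unfold u. rewrite F0. apply exp_0.
    + unfold u1. ring.
  - intros r. split; [reflexivity | apply exp_pos].
Qed.

Lemma potential_quadratic (X : Rbar) (sigma : R) (Q : R -> R) (L0 : R) :
  0 < sigma ->
  filterlim (fun r => Q r / r ^ 2) (at_right 0) (locally L0) ->
  exists K del, 0 < del /\
    forall r, Ioo X r -> r < del -> potential sigma Q r <= K * r ^ 2.
Proof.
  intros Hs HL.
  destruct (proj1 (filterlim_locally _ L0) HL (mkposreal 1 Rlt_0_1)) as [d Hd].
  exists ((L0 + 1) / sigma ^ 4), d. split; [apply cond_pos |].
  intros r [Hr _] Hrd.
  assert (Hb : Rabs (Q r / r ^ 2 - L0) < 1).
  { apply (Hd r); [| exact Hr].
    change (Rabs (r - 0) < d). rewrite Rminus_0_r, Rabs_pos_eq; lra. }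
  apply Rabs_def2 in Hb.
  assert (0 < r ^ 2) by (apply pow_lt; lra).
  assert (0 < / sigma ^ 4) by (apply Rinv_0_lt_compat, pow_lt, Hs).
  unfold potential.
  replace (Q r / sigma ^ 4) with (Q r / r ^ 2 * r ^ 2 * / sigma ^ 4) by (field; lra).
  replace ((L0 + 1) / sigma ^ 4 * r ^ 2) with ((L0 + 1) * r ^ 2 * / sigma ^ 4)
    by (field; lra).
  apply Rmult_le_compat_r; [lra |]. apply Rmult_le_compat_r; lra.
Qed.

(** Only the regularity of [phi] at [0] needs an argument. From [u' = O(r ^ 3)]
    follows [phi = O(r ^ 2)], so that each term of the equation for [phi'] is
    [O(r)] and [phi'] extends continuously by [0]. As [u'(0)], [phi(0)] and
    [Q(0)] vanish, total division lets the same formulas for [phi] and [phi']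
    take the value [0] at [r = 0]. *)
Lemma radial_sol_R (X : Rbar) (sigma : R) (n : nat) (Q u u1 : R -> R) (L0 : R) :
  Rbar_lt 0 X -> 0 < sigma -> continuous_on (Ico X) Q ->
  (forall r, Ico X r -> 0 <= Q r) -> Q 0 = 0 ->
  filterlim (fun r => Q r / r ^ 2) (at_right 0) (locally L0) ->
  radial_sol X n (potential sigma Q) u u1 ->
  regular_sol_R X sigma (S n) Q (fun r => 1 / r * (u1 r / u r)).
Proof.
  intros HX Hs CQ HQ Q0 HL S.
  assert (HW := potential_nonneg X sigma Q Hs HQ).
  assert (U := radial_ge_1 X n _ u u1 HX HW S).
  assert (U1 := radial_deriv_nonneg X n _ u u1 HX HW S).
  destruct (potential_quadratic X sigma Q L0 Hs HL) as (K & del & Hdel & HK).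
  destruct (radial_deriv_small X n _ u u1 K del HX HW S Hdel HK)
    as (K' & del' & K'pos & Hdel' & HK').
  destruct S as (Cu & Cu1 & Du & Du1 & U0 & U10).
  set (phi := fun r => 1 / r * (u1 r / u r)).
  set (phi1 := fun r => - r * phi r ^ 2 - INR (S n) / r * phi r + Q r / (sigma ^ 4 * r)).
  assert (Phi0 : phi 0 = 0) by (unfold phi; rewrite U10; unfold Rdiv; ring).
  assert (CIphi : continuous_on (Ioo X) phi).
  { assert (Cu' := continuous_on_interior X u Cu).
    assert (Cu1' := continuous_on_interior X u1 Cu1).
    unfold phi. cont_on; intros r Hr.
    - destruct Hr; lra.
    - generalize (U r (Ioo_Ico X r Hr)); lra. }
  assert (CIphi1 : continuous_on (Ioo X) phi1).
  { assert (CQ' := continuous_on_interior X Q CQ).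
    assert (0 < sigma ^ 4) by (apply pow_lt, Hs).
    unfold phi1. cont_on; intros r [Hr _]; [lra |].
    apply Rgt_not_eq, Rmult_lt_0_compat; lra. }
  assert (B : forall r, Ioo X r -> r < del' -> 0 <= phi r <= K' * r ^ 2).
  { intros r Hr Hrd. assert (Hr0 : 0 < r) by apply Hr.
    generalize (U r (Ioo_Ico X r Hr)) (U1 r Hr) (HK' r Hr Hrd). intros.
    assert (0 <= u1 r / u r) by (apply Rle_mult_inv_pos; lra).
    assert (u1 r / u r <= u1 r).
    { apply (Rmult_le_reg_r (u r)); [lra |].
      replace (u1 r / u r * u r) with (u1 r) by (field; lra). nra. }
    unfold phi. split.
    - apply Rmult_le_pos; [apply Rle_mult_inv_pos; lra | assumption].
    - apply (Rmult_le_reg_l r); [lra |].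
      replace (r * (1 / r * (u1 r / u r))) with (u1 r / u r) by (field; lra).
      replace (r * (K' * r ^ 2)) with (K' * r ^ 3) by ring. lra. }
  assert (Cphi : continuous_on (Ico X) phi).
  { apply (continuous_on_of_bound X phi K' (Rmin del' 1)); auto.
    - apply Rmin_pos; lra.
    - intros r Hr Hrd.
      assert (Hrd1 := Rlt_le_trans _ _ _ Hrd (Rmin_l _ _)).
      assert (Hrd2 := Rlt_le_trans _ _ _ Hrd (Rmin_r _ _)).
      assert (Hr0 : 0 < r) by apply Hr.
      destruct (B r Hr Hrd1). rewrite Rabs_pos_eq by lra.
      apply Rle_trans with (1 := H0).
      replace (K' * r ^ 2) with (K' * r * r) by ring.
      assert (0 <= K' * r) by (apply Rmult_le_pos; lra). nra. }
  assert (Cphi1 : continuous_on (Ico X) phi1).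
  { apply (continuous_on_of_bound X phi1 (K' ^ 2 + INR (S n) * K' + K)
      (Rmin (Rmin del del') 1)); auto.
    - unfold phi1. rewrite Phi0, Q0. unfold Rdiv. ring.
    - repeat apply Rmin_pos; lra.
    - intros r Hr Hrd.
      assert (Hrd1 := Rlt_le_trans _ _ _ Hrd (Rmin_l _ _)).
      assert (Hrd2 := Rlt_le_trans _ _ _ Hrd (Rmin_r _ _)).
      assert (Hrd3 := Rlt_le_trans _ _ _ Hrd1 (Rmin_l _ _)).
      assert (Hrd4 := Rlt_le_trans _ _ _ Hrd1 (Rmin_r _ _)).
      assert (Hr0 : 0 < r) by apply Hr.
      destruct (B r Hr Hrd4) as [Bl Bu].
      generalize (HK r Hr Hrd3) (HW r Hr). intros.
      assert (E1 : 0 <= r * phi r ^ 2 <= K' ^ 2 * r).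
      { assert (phi r <= K').
        { apply Rle_trans with (1 := Bu). assert (r ^ 2 <= 1) by nra. nra. }
        assert (0 <= phi r ^ 2 <= K' ^ 2).
        { split; [apply pow2_ge_0 | apply pow_incr; lra]. }
        split; nra. }
      assert (E2 : 0 <= INR (S n) / r * phi r <= INR (S n) * K' * r).
      { generalize (pos_INR (S n)); intros HN.
        assert (0 <= INR (S n) / r) by (apply Rle_mult_inv_pos; lra).
        split; [apply Rmult_le_pos; lra |].
        replace (INR (S n) * K' * r) with (INR (S n) / r * (K' * r ^ 2)) by (field; lra).
        apply Rmult_le_compat_l; lra. }
      assert (E3 : 0 <= Q r / (sigma ^ 4 * r) <= K * r).
      { replace (Q r / (sigma ^ 4 * r)) with (potential sigma Q r / r)
          by (unfold potential; field; split; lra).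
        split; [apply Rle_mult_inv_pos; lra |].
        apply (Rmult_le_reg_r r); [lra |].
        replace (potential sigma Q r / r * r) with (potential sigma Q r) by (field; lra).
        lra. }
      unfold phi1. apply Rabs_le. split; lra. }
  exists phi1. split; [split |]; auto.
  apply deriv_on_of_interior; auto.
  intros r Hr. assert (Hr0 : 0 < r) by apply Hr.
  generalize (U r (Ioo_Ico X r Hr)); intros Ur.
  replace (phi1 r) with ((- 1 / r ^ 2) * (u1 r / u r) + 1 / r *
    (((potential sigma Q r * u r - INR n / r * u1 r) * u r - u1 r * u1 r) / u r ^ 2)).
  - apply (is_derive_mult (fun r => 1 / r) (fun r => u1 r / u r) r);
      [auto_derive; [lra | field; lra] | apply is_derive_div; auto; lra | exact Rmult_comm].
  - unfold phi1, phi, potential. rewrite S_INR. field. repeat split; lra.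
Qed.

Lemma sol_S_to_H (X : Rbar) (sigma : R) (n : nat) (Q u : R -> R) :
  Rbar_lt 0 X -> 0 < sigma -> (forall r, Ico X r -> 0 <= Q r) ->
  regular_sol_S X sigma (S n) Q u ->
  regular_sol_H X sigma (S n) Q (fun r => - 2 * sigma ^ 2 * ln (u r)).
Proof.
  intros HX Hs HQ S.
  assert (U : forall r, Ico X r -> 1 <= u r).
  { destruct (sol_S_radial X sigma n Q u S) as (v1 & _ & Sv).
    apply (radial_ge_1 X n (potential sigma Q) u v1); auto.
    apply potential_nonneg; assumption. }
  destruct S as (u1 & u2 & (Du & Du1 & Cu2) & E & U0 & U10).
  assert (Cu := deriv_on_continuous X u u1 Du).
  assert (Cu1 := deriv_on_continuous X u1 u2 Du1).
  assert (U' : forall r, Ico X r -> u r <> 0) by (intros r Hr; generalize (U r Hr); lra).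
  assert (U2 : forall r, Ico X r -> u r ^ 2 <> 0) by (intros r Hr; apply pow_nonzero; auto).
  set (z := fun r => - 2 * sigma ^ 2 * ln (u r)).
  set (z1 := fun r => - 2 * sigma ^ 2 * (u1 r / u r)).
  set (z2 := fun r => - 2 * sigma ^ 2 * ((u2 r * u r - u1 r * u1 r) / u r ^ 2)).
  assert (Cz : continuous_on (Ico X) z).
  { unfold z. cont_on. apply (continuous_on_comp _ ln u); [| exact Cu].
    intros r Hr. apply continuity_pt_filterlim, derivable_continuous_pt.
    exists (/ u r). apply derivable_pt_lim_ln. generalize (U r Hr); lra. }
  assert (Cz1 : continuous_on (Ico X) z1) by (unfold z1; cont_on).
  assert (Cz2 : continuous_on (Ico X) z2) by (unfold z2; cont_on).
  exists z1, z2. conj_split; auto.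
  - apply deriv_on_of_interior; auto. intros r Hr.
    apply (is_derive_scal (fun r => ln (u r)) r (- 2 * sigma ^ 2)).
    apply (is_derive_comp ln u r).
    + apply is_derive_Reals, derivable_pt_lim_ln. generalize (U r (Ioo_Ico X r Hr)); lra.
    + apply (is_derive_deriv_on X); assumption.
  - apply deriv_on_of_interior; auto. intros r Hr.
    apply (is_derive_scal (fun r => u1 r / u r) r (- 2 * sigma ^ 2)).
    apply is_derive_div; try apply (is_derive_deriv_on X); auto.
    apply U', Ioo_Ico, Hr.
  - intros r Hr. generalize (E r Hr) (U r (Ioo_Ico X r Hr)); intros Er Ur.
    assert (0 < r) by apply Hr.
    unfold z2, z1.
    replace (u2 r) with (Q r / sigma ^ 4 * u r - (INR (S n) - 1) / r * u1 r) by lra.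
    field. repeat split; lra.
  - unfold z. rewrite U0, ln_1. ring.
  - unfold z1. rewrite U10. unfold Rdiv. ring.
Qed.

Lemma sol_H_to_S (X : Rbar) (sigma : R) (n : nat) (Q z : R -> R) :
  Rbar_lt 0 X -> 0 < sigma -> regular_sol_H X sigma (S n) Q z ->
  regular_sol_S X sigma (S n) Q (fun r => exp (- z r / (2 * sigma ^ 2))).
Proof.
  intros HX Hs (z1 & z2 & (Dz & Dz1 & Cz2) & E & Z0 & Z10).
  assert (Cz := deriv_on_continuous X z z1 Dz).
  assert (Cz1 := deriv_on_continuous X z1 z2 Dz1).
  assert (Hs2 : 2 * sigma ^ 2 <> 0) by nra.
  set (u := fun r => exp (- z r / (2 * sigma ^ 2))).
  set (u1 := fun r => - z1 r / (2 * sigma ^ 2) * u r).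
  set (u2 := fun r => - z2 r / (2 * sigma ^ 2) * u r + - z1 r / (2 * sigma ^ 2) * u1 r).
  assert (Cu : continuous_on (Ico X) u).
  { apply (continuous_on_comp _ exp (fun r => - z r / (2 * sigma ^ 2)));
      [intros; apply continuous_exp | cont_on; auto]. }
  assert (Cu1 : continuous_on (Ico X) u1) by (unfold u1; cont_on; auto).
  assert (Cu2 : continuous_on (Ico X) u2) by (unfold u2; cont_on; auto).
  assert (Lin : forall f r l, is_derive f r l ->
    is_derive (fun r => - f r / (2 * sigma ^ 2)) r (- l / (2 * sigma ^ 2))).
  { intros f r l Hf.
    assert (Ef : forall y, - / (2 * sigma ^ 2) * y = - y / (2 * sigma ^ 2))
      by (intros; unfold Rdiv; ring).
    apply (is_derive_ext (fun r => - / (2 * sigma ^ 2) * f r) _ r _ (fun t => Ef (f t))).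
    rewrite <- Ef. apply (is_derive_scal f), Hf. }
  assert (Iu : forall r, Ioo X r -> is_derive u r (u1 r)).
  { intros r Hr. apply (is_derive_comp exp (fun r => - z r / (2 * sigma ^ 2)) r).
    - apply is_derive_exp.
    - apply Lin, (is_derive_deriv_on X); assumption. }
  exists u1, u2. conj_split; auto.
  - apply deriv_on_of_interior; auto.
  - apply deriv_on_of_interior; auto. intros r Hr.
    apply (is_derive_mult (fun r => - z1 r / (2 * sigma ^ 2)) u r); auto.
    + apply Lin, (is_derive_deriv_on X); assumption.
    + exact Rmult_comm.
  - intros r Hr. generalize (E r Hr); intros Er. assert (0 < r) by apply Hr.
    unfold u2, u1.
    replace (z2 r) with (- ((INR (S n) - 1) / r * z1 r)
      + 1 / (2 * sigma ^ 2) * z1 r ^ 2 - 2 * Q r / sigma ^ 2) by lra.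
    field. split; lra.
  - unfold u. rewrite Z0. replace (- 0 / (2 * sigma ^ 2)) with 0 by (unfold Rdiv; ring).
    apply exp_0.
  - unfold u1. rewrite Z10. unfold Rdiv. ring.
Qed.

Lemma sol_S_unique (X : Rbar) (sigma : R) (n : nat) (Q u v : R -> R) :
  Rbar_lt 0 X -> 0 < sigma -> (forall r, Ico X r -> 0 <= Q r) ->
  regular_sol_S X sigma (S n) Q u -> regular_sol_S X sigma (S n) Q v ->
  eq_on (Ico X) v u.
Proof.
  intros HX Hs HQ Su Sv.
  destruct (sol_S_radial X sigma n Q u Su) as (u1 & _ & Ru).
  destruct (sol_S_radial X sigma n Q v Sv) as (v1 & _ & Rv).
  apply (radial_unique X n (potential sigma Q) u u1 v v1); auto.
  apply potential_nonneg; assumption.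
Qed.

(** The function [u] rebuilt from [phi] satisfies the relation, and it is the
    only solution of the linear problem; uniqueness for the nonlinear problems
    is inherited from the linear one in this way. *)
Lemma sol_S_R_relation (X : Rbar) (sigma : R) (n : nat) (Q phi u u1 : R -> R) :
  Rbar_lt 0 X -> 0 < sigma -> (forall r, Ico X r -> 0 <= Q r) ->
  regular_sol_R X sigma (S n) Q phi -> regular_sol_S X sigma (S n) Q u ->
  deriv_on (Ico X) u u1 -> forall r, Ioo X r -> phi r = 1 / r * (u1 r / u r).
Proof.
  intros HX Hs HQ HR HS Du r Hr.
  destruct (sol_R_to_S X sigma n Q phi HX Hs HR) as (v & v1 & Sv & Dv & V).
  assert (Huv := sol_S_unique X sigma n Q v u HX Hs HQ Sv HS).
  rewrite (Huv r (Ioo_Ico X r Hr)).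
  rewrite (deriv_on_unique X u v u1 v1 r Du Huv
    (is_derive_deriv_on X v v1 r Dv Hr) Hr).
  destruct (V r) as [-> Vr]. destruct Hr. field. lra.
Qed.

Lemma sol_R_unique (X : Rbar) (sigma : R) (n : nat) (Q phi psi : R -> R) :
  Rbar_lt 0 X -> 0 < sigma -> (forall r, Ico X r -> 0 <= Q r) ->
  regular_sol_R X sigma (S n) Q phi -> regular_sol_R X sigma (S n) Q psi ->
  eq_on (Ico X) psi phi.
Proof.
  intros HX Hs HQ Hphi Hpsi r Hr.
  destruct (Ico_cases X r Hr) as [-> | Hr0].
  - destruct Hphi as (? & _ & _ & ->), Hpsi as (? & _ & _ & ->). reflexivity.
  - destruct (sol_R_to_S X sigma n Q phi HX Hs Hphi) as (v & v1 & Sv & Dv & _).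
    rewrite (sol_S_R_relation X sigma n Q phi v v1) by assumption.
    apply (sol_S_R_relation X sigma n Q psi v v1); assumption.
Qed.

(** As for [phi]: the exponential of [z] is a solution of the linear problem,
    hence equal to [u]. *)
Lemma sol_S_H_relation (X : Rbar) (sigma : R) (n : nat) (Q u z : R -> R) :
  Rbar_lt 0 X -> 0 < sigma -> (forall r, Ico X r -> 0 <= Q r) ->
  regular_sol_S X sigma (S n) Q u -> regular_sol_H X sigma (S n) Q z ->
  forall r, Ico X r -> z r = - 2 * sigma ^ 2 * ln (u r) /\
    u r = exp (- z r / (2 * sigma ^ 2)).
Proof.
  intros HX Hs HQ Su Hz r Hr.
  assert (E := sol_S_unique X sigma n Q _ u HX Hs HQ
    (sol_H_to_S X sigma n Q z HX Hs Hz) Su r Hr).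
  simpl in E. split; [| exact E].
  rewrite E, ln_exp. field. lra.
Qed.

Lemma sol_H_unique (X : Rbar) (sigma : R) (n : nat) (Q z y : R -> R) :
  Rbar_lt 0 X -> 0 < sigma -> (forall r, Ico X r -> 0 <= Q r) ->
  regular_sol_H X sigma (S n) Q z -> regular_sol_H X sigma (S n) Q y ->
  eq_on (Ico X) y z.
Proof.
  intros HX Hs HQ Hz Hy r Hr.
  assert (Su := sol_H_to_S X sigma n Q z HX Hs Hz).
  destruct (sol_S_H_relation X sigma n Q _ z HX Hs HQ Su Hz r Hr) as [-> _].
  apply (sol_S_H_relation X sigma n Q _ y HX Hs HQ Su Hy r Hr).
Qed.

Lemma bijective_graph_of_unique (D : R -> Prop) (A B : (R -> R) -> Prop)
    (G : (R -> R) -> (R -> R) -> Prop) :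
  (forall f f', A f -> A f' -> eq_on D f' f) ->
  (forall g g', B g -> B g' -> eq_on D g' g) ->
  (forall f, A f -> exists g, B g /\ G f g) ->
  (forall g, B g -> exists f, A f /\ G f g) ->
  bijective_graph D A B G.
Proof.
  intros UA UB HA HB. split.
  - intros f Hf. destruct (HA f Hf) as (g & Hg & Hfg).
    exists g; split; [split; assumption |]. intros g' [Hg' _]. apply UB; assumption.
  - intros g Hg. destruct (HB g Hg) as (f & Hf & Hfg).
    exists f; split; [split; assumption |]. intros f' [Hf' _]. apply UA; assumption.
Qed.

(** Dividing [Q] by [sigma ^ 4 r ^ 2] turns the equation into
    [phi' = r (q - phi ^ 2) - (N / r) phi] with [q -> L / sigma ^ 4]. *)
Lemma sol_R_limit (sigma : R) (n : nat) (Q phi : R -> R) (L : R) :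
  0 < sigma -> regular_sol_R p_infty sigma (S n) Q phi ->
  (forall r, 0 < r -> 0 <= phi r) ->
  0 < L -> is_lim (fun r => Q r / r ^ 2) p_infty L ->
  is_lim phi p_infty (sqrt L / sigma ^ 2).
Proof.
  intros Hs (phi1 & (Dphi & _) & E & _) Hphi HL Hlim.
  apply (riccati_limit (S n) (fun r => Q r / r ^ 2 * / sigma ^ 4)).
  - apply Rdiv_lt_0_compat; [apply sqrt_lt_R0, HL | apply pow_lt, Hs].
  - replace (Finite ((sqrt L / sigma ^ 2) ^ 2))
      with (Rbar_mult (Finite L) (Finite (/ sigma ^ 4))).
    + apply is_lim_scal_r, Hlim.
    + simpl. f_equal. rewrite <- (sqrt_sqrt L) at 1 by lra. field. lra.
  - exact Hphi.
  - intros r Hr. assert (Hr' : Ioo p_infty r) by (split; [exact Hr | exact I]).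
    replace (r * (Q r / r ^ 2 * / sigma ^ 4 - phi r ^ 2) - INR (S n) / r * phi r)
      with (phi1 r).
    + apply (is_derive_deriv_on p_infty); assumption.
    + rewrite (E r Hr'). field. split; lra.
Qed.

(** * The equivalence theorem *)

Theorem theorem5p2
  (X : Rbar) (hX : Rbar_lt 0 X)
  (sigma : R) (hsigma : 0 < sigma)
  (N : nat) (hN : (1 <= N)%nat)
  (Q : R -> R)
  (hQcont : continuous_on (Ico X) Q)
  (hQnonneg : forall r, Ico X r -> 0 <= Q r)
  (hQ0 : Q 0 = 0)
  (L0 : R) (hL0 : 0 <= L0)
  (hQlim : filterlim (fun r => Q r / r ^ 2) (at_right 0) (locally L0))
  (hsol : (exists phi, regular_sol_R X sigma N Q phi) \/
          (exists u, regular_sol_S X sigma N Q u) \/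
          (exists z, regular_sol_H X sigma N Q z)) :
  exists_unique_on (Ico X) (regular_sol_R X sigma N Q) /\
  exists_unique_on (Ico X) (regular_sol_S X sigma N Q) /\
  exists_unique_on (Ico X) (regular_sol_H X sigma N Q) /\
  bijective_graph (Ico X)
    (regular_sol_S X sigma N Q) (regular_sol_R X sigma N Q) (graph_S_R X) /\
  bijective_graph (Ico X)
    (regular_sol_S X sigma N Q) (regular_sol_H X sigma N Q) (graph_S_H X sigma) /\
  bijective_graph (Ico X)
    (regular_sol_H X sigma N Q) (regular_sol_S X sigma N Q) (graph_H_S X sigma) /\
  forall phi u u1 z z1 : R -> R,
    regular_sol_R X sigma N Q phi ->
    regular_sol_S X sigma N Q u -> deriv_on (Ico X) u u1 ->
    regular_sol_H X sigma N Q z -> deriv_on (Ico X) z z1 ->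
    (forall r, Ico X r -> 1 <= u r) /\
    (forall r, Ioo X r -> phi r = 1 / r * (u1 r / u r)) /\
    (forall r, Ico X r -> z r = - 2 * sigma ^ 2 * ln (u r)) /\
    (forall r, Ico X r -> u r = exp (- z r / (2 * sigma ^ 2))) /\
    (((forall r, Ioo X r -> 0 < phi r) <-> (forall r, Ioo X r -> 0 < u1 r)) /\
     ((forall r, Ioo X r -> 0 < u1 r) <-> (forall r, Ioo X r -> z1 r < 0))) /\
    ((forall r, Ioo X r -> 0 < phi r) ->
     nondecreasing_on (Ioo X) Q ->
     strictly_convex_on (Ico X) u /\ strictly_concave_on (Ico X) z) /\
    (X = p_infty ->
     forall L : R, 0 < L ->
       is_lim (fun r => Q r / r ^ 2) p_infty L ->
       is_lim phi p_infty (sqrt L / sigma ^ 2)).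
Proof.
  (* Below, [n = N - 1] is the coefficient of the first-order term of (S), (H). *)
  destruct N as [| n]; [exfalso; lia |].
  assert (UR := fun f g => sol_R_unique X sigma n Q f g hX hsigma hQnonneg).
  assert (US := fun f g => sol_S_unique X sigma n Q f g hX hsigma hQnonneg).
  assert (UH := fun f g => sol_H_unique X sigma n Q f g hX hsigma hQnonneg).
  assert (SR : forall u, regular_sol_S X sigma (S n) Q u ->
    exists phi, regular_sol_R X sigma (S n) Q phi /\ graph_S_R X u phi).
  { intros u Su. destruct (sol_S_radial X sigma n Q u Su) as (u1 & Du & Ru).
    eexists; split; [apply (radial_sol_R X sigma n Q u u1 L0); assumption |].
    exists u1; split; [exact Du | reflexivity]. }
  assert (RS : forall phi, regular_sol_R X sigma (S n) Q phi ->
    exists u, regular_sol_S X sigma (S n) Q u /\ graph_S_R X u phi).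
  { intros phi Hphi.
    destruct (sol_R_to_S X sigma n Q phi hX hsigma Hphi) as (u & u1 & Su & Du & _).
    exists u; split; [exact Su |]. exists u1; split; [exact Du |].
    apply (sol_S_R_relation X sigma n Q); assumption. }
  assert (SH := fun u => sol_S_to_H X sigma n Q u hX hsigma hQnonneg).
  assert (HS := fun z => sol_H_to_S X sigma n Q z hX hsigma).
  assert (Rel := fun u z => sol_S_H_relation X sigma n Q u z hX hsigma hQnonneg).
  assert (EU : exists u, regular_sol_S X sigma (S n) Q u).
  { destruct hsol as [[phi H] | [H | [z H]]].
    - destruct (RS phi H) as (u & Hu & _). exists u; exact Hu.
    - exact H.
    - exists (fun r => exp (- z r / (2 * sigma ^ 2))). apply HS, H. }
  destruct EU as (u0 & Hu0).
  split; [| split; [| split; [| split; [| split; [| split]]]]].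
  - destruct (SR u0 Hu0) as (phi & Hphi & _). exists phi; split; [exact Hphi |]. auto.
  - exists u0; split; auto.
  - eexists; split; [apply SH, Hu0 |]. intros; apply UH; auto.
  - apply bijective_graph_of_unique; auto.
  - apply bijective_graph_of_unique; auto.
    + intros u Hu. eexists; split; [apply SH, Hu |]. intros r Hr; reflexivity.
    + intros z Hz. eexists; split; [apply HS, Hz |].
      intros r Hr. apply (Rel _ z (HS z Hz) Hz r Hr).
  - apply bijective_graph_of_unique; auto.
    + intros z Hz. eexists; split; [apply HS, Hz |]. intros r Hr; reflexivity.
    + intros u Hu. eexists; split; [apply SH, Hu |].
      intros r Hr. apply (Rel u _ Hu (SH u Hu) r Hr).
  - intros phi u u1 z z1 Hphi Su Du Hz Dz.
    destruct (sol_S_radial X sigma n Q u Su) as (v1 & Dv & Rv).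
    assert (HW := potential_nonneg X sigma Q hsigma hQnonneg).
    assert (U := radial_ge_1 X n _ u v1 hX HW Rv).
    assert (V1 := radial_deriv_nonneg X n _ u v1 hX HW Rv).
    assert (E1 : forall r, Ioo X r -> u1 r = v1 r).
    { intros r Hr. apply (deriv_on_unique X u u u1 v1 r Du (fun _ _ => eq_refl));
        [apply (is_derive_deriv_on X) |]; assumption. }
    assert (Ephi := sol_S_R_relation X sigma n Q phi u u1 hX hsigma hQnonneg Hphi Su Du).
    assert (Ez := fun r Hr => proj1 (Rel u z Su Hz r Hr)).
    assert (Ez1 : forall r, Ioo X r -> z1 r = - 2 * sigma ^ 2 * (u1 r / u r)).
    { intros r Hr.
      apply (deriv_on_unique X z (fun r => - 2 * sigma ^ 2 * ln (u r)) z1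
        (fun r => - 2 * sigma ^ 2 * (u1 r / u r))); auto.
      apply (is_derive_scal (fun r => ln (u r)) r (- 2 * sigma ^ 2)).
      apply (is_derive_comp ln u r).
      - apply is_derive_Reals, derivable_pt_lim_ln.
        generalize (U r (Ioo_Ico X r Hr)); lra.
      - apply (is_derive_deriv_on X); assumption. }
    assert (Phi_u : forall r, Ioo X r -> u1 r = r * phi r * u r).
    { intros r Hr. rewrite (Ephi r Hr). generalize (U r (Ioo_Ico X r Hr)).
      destruct Hr. intros. field; lra. }
    assert (Pos : (forall r, Ioo X r -> 0 < phi r) <-> (forall r, Ioo X r -> 0 < u1 r)).
    { split; intros H r Hr; generalize (H r Hr) (U r (Ioo_Ico X r Hr)); intros.
      - rewrite (Phi_u r Hr). destruct Hr. repeat apply Rmult_lt_0_compat; lra.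
      - rewrite (Ephi r Hr). destruct Hr.
        apply Rmult_lt_0_compat; apply Rdiv_lt_0_compat; lra. }
    split; [exact U |]. split; [exact Ephi |]. split; [exact Ez |].
    split; [exact (fun r Hr => proj2 (Rel u z Su Hz r Hr)) |].
    assert (Hs2 : 0 < 2 * sigma ^ 2) by nra.
    split; [split; [exact Pos |] | split].
    + split; intros H r Hr; generalize (H r Hr) (U r (Ioo_Ico X r Hr)); intros Hr1 Ur.
      * rewrite (Ez1 r Hr). assert (0 < u1 r / u r) by (apply Rdiv_lt_0_compat; lra). nra.
      * rewrite (Ez1 r Hr) in Hr1. assert (0 < u1 r / u r) by nra.
        replace (u1 r) with (u1 r / u r * u r) by (field; lra). nra.
    + intros Hp HQi.
      assert (Hu1 := proj1 Pos Hp).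
      assert (Incr : forall r s, Ioo X s -> 0 < r < s -> u1 r / u r < u1 s / u s).
      { intros r s Hs Hrs.
        rewrite (E1 s Hs), (E1 r) by (apply (Ioo_le X r s); [apply Ioo_Ico |]; auto; lra).
        apply (radial_log_deriv_incr X n (potential sigma Q) u v1); auto.
        - intros t Ht. rewrite <- E1 by exact Ht. auto.
        - intros a b Ha Hb Hab. apply Rmult_le_compat_r.
          + left. apply Rinv_0_lt_compat, pow_lt, hsigma.
          + apply HQi; assumption. }
      assert (Cu := deriv_on_continuous X u u1 Du).
      assert (Iu := fun r Hr => is_derive_deriv_on X u u1 r Du Hr).
      split.
      * apply (strictly_convex_of_deriv X u u1); auto.
        intros r s Hs Hrs.
        assert (Hr : Ioo X r) by (apply (Ioo_le X r s); [apply Ioo_Ico |]; auto; lra).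
        generalize (Incr r s Hs Hrs) (U r (Ioo_Ico X r Hr)) (U s (Ioo_Ico X s Hs))
          (Hu1 r Hr) (Hu1 s Hs). intros.
        assert (u r <= u s).
        { apply (Ico_incr X u u1); auto.
          - intros t Ht; left; auto.
          - lra.
          - apply Ioo_Ico, Hs. }
        replace (u1 r) with (u1 r / u r * u r) by (field; lra).
        replace (u1 s) with (u1 s / u s * u s) by (field; lra).
        assert (0 < u1 r / u r) by (apply Rdiv_lt_0_compat; lra). nra.
      * apply (strictly_concave_of_deriv X z z1); auto.
        -- apply (deriv_on_continuous X z z1 Dz).
        -- intros r Hr. apply (is_derive_deriv_on X); assumption.
        -- intros r s Hs Hrs.
           assert (Hr : Ioo X r) by (apply (Ioo_le X r s); [apply Ioo_Ico |]; auto; lra).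
           rewrite (Ez1 r Hr), (Ez1 s Hs). generalize (Incr r s Hs Hrs). nra.
    + intros -> L HL Hlim.
      apply (sol_R_limit sigma n Q phi L); auto.
      intros r Hr. assert (Hr' : Ioo p_infty r) by (split; [exact Hr | exact I]).
      rewrite (Ephi r Hr'), (E1 r Hr').
      generalize (V1 r Hr') (U r (Ioo_Ico _ r Hr')). intros.
      apply Rmult_le_pos; apply Rle_mult_inv_pos; lra.
Qed.
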